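(* Let $n\in\mathbb{Z}_{\ge 1}$ and let $q\in\mathbb{R}$ with $0<q<n$ and fractional part $\widehat q := q-\lfloor q\rfloor\neq 0$. Then the SOS rank of the unweighted minimum knapsack instance $\mathrm{MK}(q)$ on $n$ variables is lower bounded by $$ \Omega\left(\min\{\lceil q\rceil,\ n-\lfloor q\rfloor\}\right), $$ where the constant implied by $\Omega(\cdot)$ is absolute (independent of $n$ and $q$).
   Context: For $\mathbf{x}\in\{0,1\}^n$ write $|\mathbf{x}|=\sum_{i=1}^n x_i$. The instance $\mathrm{MK}(q)$ is the problem of minimizing $|\mathbf{x}|$ subject to $|\mathbf{x}|\ge q$, $\mathbf{x}\in\{0,1\}^n$; for $0\le q\le n$ its optimal value is $\lceil q\rceil$. A polynomial in $\mathbb{R}[x_1,\dots,x_n]$ is SOS if it is a finite sum of squares of real polynomials. For $0\le q\le n$, a degree-$d$ SOS certificate of optimality for $\mathrm{MK}(q)$ consists of SOS polynomials $s_0,s_1\in\mathbb{R}[x_1,\dots,x_n]$ with $\deg(s_0)\le 2d+2$, $\deg(s_1)\le 2d$ and $$|\mathbf{x}|-\lceil q\rceil = s_0(\mathbf{x})+s_1(\mathbf{x})(|\mathbf{x}|-q)\quad\text{for all }\mathbf{x}\in\{0,1\}^n.$$ The SOS rank of $\mathrm{MK}(q)$ is the smallest $d\in\mathbb{Z}_{\ge 0}$ for which such a certificate exists. *)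

(* Defs.v *)
From mathcomp Require Import all_boot all_order all_algebra.
From mathcomp Require Import boolp reals.
From mathcomp.multinomials Require Import mpoly.

Set Implicit Arguments.
Unset Strict Implicit.
Unset Printing Implicit Defensive.

Import Order.TTheory GRing.Theory Num.Theory.
Local Open Scope ring_scope.

Definition weight (n : nat) (x : {ffun 'I_n -> bool}) : nat :=
  (\sum_(i < n) x i)%N.

Definition eval_cube (R : realType) (n : nat) (p : {mpoly R[n]})
    (x : {ffun 'I_n -> bool}) : R :=
  p.@[fun i => (x i)%:R].

Definition is_sos (R : realType) (n : nat) (p : {mpoly R[n]}) : Prop :=
  exists s : seq {mpoly R[n]}, p = \sum_(g <- s) g ^+ 2.

(* [msize p] is the total degree of [p] plus one, and [0] for [p = 0]. *)
Definition deg_le (R : realType) (n : nat) (p : {mpoly R[n]}) (k : nat) : Prop :=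
  (msize p <= k.+1)%N.

(* For [0 <= q <= n], [Num.ceil q] is the minimum of [weight x] over the cube
   points [x] with [q <= weight x]. *)
Definition is_MK_certificate (R : realType) (n : nat) (q : R)
    (s0 s1 : {mpoly R[n]}) : Prop :=
  forall x : {ffun 'I_n -> bool},
    (weight x)%:R - (Num.ceil q)%:~R =
      eval_cube s0 x + eval_cube s1 x * ((weight x)%:R - q).

Definition MK_certifiable (R : realType) (n : nat) (q : R) (d : nat) : Prop :=
  exists s0 s1 : {mpoly R[n]},
    [/\ is_sos s0, is_sos s1, deg_le s0 (2 * d + 2), deg_le s1 (2 * d)
      & is_MK_certificate q s0 s1].

(* The default value [0] is never used, since a certificate always exists:
   see [MK_sos_rankP]. *)
Definition MK_sos_rank (R : realType) (n : nat) (q : R) : nat :=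
  if pselect (exists d, `[< MK_certifiable n q d >]) is left certifiable
  then ex_minn certifiable else 0%N.

Definition cube_indicator (R : realType) (n : nat) (a : {ffun 'I_n -> bool}) :
    {mpoly R[n]} :=
  \prod_(i < n) (if a i then 'X_i else 1 - 'X_i).

Lemma eval_cube_indicator (R : realType) (n : nat) (a x : {ffun 'I_n -> bool}) :
  eval_cube (cube_indicator R a) x = (x == a)%:R.
Proof.
rewrite /eval_cube /cube_indicator rmorph_prod /=.
under eq_bigr => i _ do
  have -> : (if a i then 'X_i else 1 - 'X_i : {mpoly R[n]}).@[fun i => (x i)%:R]
            = (x i == a i)%:R by
    case: (a i); rewrite ?mevalB ?meval1 mevalXU; case: (x i);
    rewrite ?subrr ?subr0.
case: eqP => [->|/eqP xa]; first by rewrite big1 // => i _; rewrite eqxx.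
have /existsP[i xai] : [exists i, x i != a i].
  apply: contraR xa => /existsPn xa; apply/eqP/ffunP => i.
  by have /negPn/eqP := xa i.
by rewrite (bigD1 i) //= (negPf xai) mul0r.
Qed.

Lemma msizeM_pred (R : realType) (n : nat) (p q : {mpoly R[n]}) :
  (msize (p * q) <= (msize p + msize q).-1)%N.
Proof.
have [->|p0] := eqVneq p 0; first by rewrite mul0r msize0.
have [->|q0] := eqVneq q 0; first by rewrite mulr0 msize0.
by rewrite msizeM.
Qed.

Lemma msize_prod_le (R : realType) (n : nat) (I : Type) (r : seq I)
    (F : I -> {mpoly R[n]}) :
  (forall i, (msize (F i) <= 2)%N) ->
  (msize (\prod_(i <- r) F i) <= (size r).+1)%N.
Proof.
move=> F2; elim: r => [|i r IH]; first by rewrite big_nil msize1.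
rewrite big_cons /=; apply: leq_trans (msizeM_pred _ _) _.
have := leq_add (F2 i) IH; rewrite !addSn add0n.
by case: (_ + _)%N.
Qed.

Lemma msize_cube_indicator (R : realType) (n : nat) (a : {ffun 'I_n -> bool}) :
  (msize (cube_indicator R a) <= n.+1)%N.
Proof.
have := @msize_prod_le R n _ (index_enum 'I_n)
  (fun i => if a i then 'X_i else 1 - 'X_i).
rewrite -[size _]/(size (index_enum 'I_n)).
have -> : size (index_enum 'I_n) = n.
  by rewrite -[index_enum _]enumT size_enum_ord.
move=> H; apply: H => i; case: (a i); first by rewrite msizeX mdeg1.
apply: leq_trans (msizeD_le _ _) _.
by rewrite geq_max msizeN msizeX mdeg1 msize1.
Qed.

Definition cube_interp (R : realType) (n : nat)
    (f : {ffun 'I_n -> bool} -> R) : {mpoly R[n]} :=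
  \sum_(a : {ffun 'I_n -> bool}) (Num.sqrt (f a) *: cube_indicator R a) ^+ 2.

Lemma eval_cube_interp (R : realType) (n : nat)
    (f : {ffun 'I_n -> bool} -> R) (x : {ffun 'I_n -> bool}) :
  (forall a, 0 <= f a) -> eval_cube (cube_interp f) x = f x.
Proof.
move=> f0; rewrite /eval_cube /cube_interp rmorph_sum /=.
under eq_bigr => a _ do
  rewrite rmorphXn /= mevalZ -/(eval_cube _ _) eval_cube_indicator.
rewrite (bigD1 x) //= eqxx mulr1 sqr_sqrtr // big1 ?addr0 // => a.
by rewrite eq_sym => /negPf ->; rewrite mulr0 expr0n.
Qed.

Lemma is_sos_cube_interp (R : realType) (n : nat)
    (f : {ffun 'I_n -> bool} -> R) : is_sos (cube_interp f).
Proof.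
exists [seq Num.sqrt (f a) *: cube_indicator R a | a <- index_enum _].
by rewrite big_map.
Qed.

Lemma deg_le_cube_interp (R : realType) (n : nat)
    (f : {ffun 'I_n -> bool} -> R) : deg_le (cube_interp f) (2 * n).
Proof.
rewrite /deg_le /cube_interp; apply: leq_trans (msize_sum _ _ _) _.
apply/bigmax_leqP => a _; rewrite expr2.
apply: leq_trans (msizeM_pred _ _) _.
have Hm : (msize (Num.sqrt (f a) *: cube_indicator R a) <= n.+1)%N.
  exact: leq_trans (msizeZ_le _ _) (msize_cube_indicator R a).
have := leq_add Hm Hm; rewrite mul2n -addnn addSn addnS.
by case: (_ + _)%N.
Qed.

Lemma MK_certifiable_n (R : realType) (n : nat) (q : R) : MK_certifiable n q n.
Proof.
pose f (a : {ffun 'I_n -> bool}) : R :=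
  if q <= (weight a)%:R then (weight a)%:R - (Num.ceil q)%:~R else 0.
pose g (a : {ffun 'I_n -> bool}) : R :=
  if q <= (weight a)%:R then 0
  else ((Num.ceil q)%:~R - (weight a)%:R) / (q - (weight a)%:R).
have f0 a : 0 <= f a.
  rewrite /f; case: ifPn => // qa.
  by rewrite subr_ge0 -[_%:R]/((Posz (weight a))%:~R) ler_int ceil_le_int.
have g0 a : 0 <= g a.
  rewrite /g; case: ifPn => //; rewrite -ltNge => aq.
  rewrite divr_ge0 ?subr_ge0 ?(ltW aq) //.
  exact: le_trans (ltW aq) (ceil_ge _).
exists (cube_interp f), (cube_interp g); split.
- exact: is_sos_cube_interp.
- exact: is_sos_cube_interp.
- by apply: leq_trans (deg_le_cube_interp f) _; rewrite ltnS leq_addr.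
- exact: deg_le_cube_interp.
move=> x; rewrite !eval_cube_interp // /f /g.
case: ifPn => [_|]; first by rewrite mul0r addr0.
rewrite -ltNge => xq; rewrite add0r -[in RHS](opprB q) mulrN divfK.
  by rewrite opprB.
by rewrite subr_eq0 gt_eqF.
Qed.

Lemma MK_sos_rankP (R : realType) (n : nat) (q : R) :
  MK_certifiable n q (MK_sos_rank n q) /\
  (forall d, MK_certifiable n q d -> (MK_sos_rank n q <= d)%N).
Proof.
rewrite /MK_sos_rank; case: pselect => [ex|[]]; last first.
  by exists n; apply/asboolP/MK_certifiable_n.
by case: ex_minnP => d /asboolP ? dmin; split=> // k /asboolP /dmin.
Qed.

(* Main.v *)
Require Import Defs.
From mathcomp Require Import all_boot all_order all_algebra.
From mathcomp Require Import boolp reals.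
From mathcomp.multinomials Require Import mpoly.
From mathcomp Require Import zify ring lra.

Set Implicit Arguments.
Unset Strict Implicit.
Unset Printing Implicit Defensive.

Import Order.TTheory GRing.Theory Num.Theory.
Local Open Scope ring_scope.

(* The pseudo-expectation E with E[x_I] = g(|I|), where
   g(j) = prod_{i<j} (q-i)/(n-i), kills every multiple of |x| - q of degree at
   most n.  For t = d+1 it is nonnegative on squares of polynomials of degree at
   most t as soon as q > 2t-1 and n-q >= t-1: since |x| acts as multiplication
   by q, its moment matrix is determined by its block |I| = |J| = t, which is
   sum_S lambda_|S| [S <= I][S <= J], where lambda_j is the j-th backward
   difference of g at 2t and has a closed form that is nonnegative.  Applied to
   a degree-d certificate, E gives 0 <= E[|x| - ceil q] = q - ceil q < 0.  The
   case d = 0, where q may be too small for this, is elementary. *)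

(** * Sums over subsets and inversion over supersets *)

Section SetSums.

Lemma sum_subsetsU1 (R : nmodType) (T : finType) (x : T) (A : {set T})
    (F : {set T} -> R) : x \notin A ->
  \sum_(S : {set T} | S \subset x |: A) F S =
  \sum_(S : {set T} | S \subset A) (F S + F (x |: S)).
Proof.
move=> xA; rewrite big_split /= (bigID (fun S : {set T} => x \in S)) /= addrC.
congr (_ + _).
  apply: eq_bigl => S; apply/andP/idP => [[SA xS]|SA].
    apply/subsetP => y yS; have := subsetP SA y yS.
    by rewrite !inE => /orP[/eqP yx|//]; rewrite -yx yS in xS.
  split; first exact: subset_trans SA (subsetUr _ _).
  by apply: contra xA => /(subsetP SA).
rewrite (reindex_onto (fun S => x |: S) (fun S => S :\ x)) /=; last first.
  by move=> S /andP[_ xS]; rewrite setD1K.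
apply: eq_bigl => S; rewrite setU11 andbT.
apply/andP/idP => [[SA /eqP Sx]|SA].
  rewrite -Sx; apply/subsetP => y; rewrite !inE => /andP[yx /orP[/eqP yx'|yS]].
    by rewrite yx' eqxx in yx.
  by have := subsetP SA y; rewrite !inE yS orbT (negPf yx) => /(_ isT).
split; first exact: setUS.
by rewrite setU1K //; apply: contra xA => /(subsetP SA).
Qed.

(** Inversion over supersets, from the full set downwards: the value at [I] is fixed by those at its
    strict supersets. It realizes prescribed pseudo-moments by a signed measure on the cube, against
    which identities valid only at cube points can be summed. *)
Lemma moment_measure (R : comRingType) (T : finType) (g : {set T} -> R) :
  exists mu : {set T} -> R,
    forall I : {set T}, \sum_(A : {set T} | I \subset A) mu A = g I.
Proof.
suff H (k : nat) : exists mu : {set T} -> R, forall I : {set T},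
    (#|~: I| < k)%N -> \sum_(A : {set T} | I \subset A) mu A = g I.
  have [mu hmu] := H #|T|.+1; exists mu => I; apply: hmu.
  by rewrite ltnS max_card.
elim: k => [|k [mu hmu]]; first by exists (fun=> 0).
pose nu (I : {set T}) := if #|~: I| == k
  then g I - \sum_(A : {set T} | (I \subset A) && (A != I)) mu A else mu I.
exists nu => I Ik; rewrite (bigD1 I) //=.
have nuA (A : {set T}) : I \subset A -> A != I -> nu A = mu A.
  move=> IA AI; rewrite /nu ifF //; apply/eqP => Ak.
  have : I \proper A by rewrite properEneq eq_sym AI.
  by move=> /proper_card; have := cardsC A; have := cardsC I; lia.
rewrite (eq_bigr mu); last by move=> A /andP[]; exact: nuA.
rewrite /nu; case: ifPn => [_|Ik']; first by rewrite subrK.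
by rewrite -(hmu I) ?[RHS](bigD1 I) //=; lia.
Qed.

End SetSums.

(** * Pseudo-moments, their differences, and the moment matrix *)

Section Moments.
Variables (R : realFieldType) (n : nat) (q : R).

(** For an integer q in [0, n] and j <= n, the probability that a uniformly random q-subset of n
    points contains j given points. *)
Definition mom (j : nat) : R := \prod_(i < j) ((q - i%:R) / (n%:R - i%:R)).

Lemma mom0 : mom 0 = 1.
Proof. by rewrite /mom big_ord0. Qed.

Lemma momS j : (j < n)%N -> (n%:R - j%:R) * mom j.+1 = (q - j%:R) * mom j.
Proof.
move=> jn; rewrite /mom big_ord_recr /=; set P := \prod_(_ < _) _.
have : (n%:R - j%:R : R) != 0 by rewrite subr_eq0 eqr_nat; lia.
by move=> ?; field.
Qed.

(** The j-th backward difference of [mom] at [m], with sign (-1)^j. For integer q and j <= m <= n: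
    the probability that a random q-subset contains m - j given points and avoids j others. *)
Fixpoint momdiff (j m : nat) : R :=
  if j is j'.+1 then momdiff j' m.-1 - momdiff j' m else mom m.

(** Binomial expansion: a step back is the identity plus the signed difference, and subsets of [A]
    index the terms of the k-th power. *)
Lemma momdiff_sum (T : finType) (k : nat) (A : {set T}) (j m : nat) :
  #|A| = k -> (k <= m)%N ->
  momdiff j (m - k) = \sum_(S : {set T} | S \subset A) momdiff (j + #|S|) m.
Proof.
elim: k A m => [|k IH] A m Ak km.
  move/cards0_eq: Ak => ->; rewrite (big_pred1 set0) ?cards0 ?addn0 ?subn0 //.
  by move=> S /=; rewrite subset0.
have [x xA] : exists x, x \in A by apply/set0Pn; rewrite -card_gt0 Ak.
rewrite -(setD1K xA) sum_subsetsU1 ?setD11 //.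
have Ak' : #|A :\ x| = k by have := cardsD1 x A; rewrite xA; lia.
have -> : (m - k.+1 = m.-1 - k)%N by lia.
rewrite (IH _ _ Ak'); last by lia.
apply: eq_bigr => S SA; rewrite cardsU1.
have -> : x \notin S by apply/negP => /(subsetP SA); rewrite setD11.
by rewrite addnCA add1n /= addrC subrK.
Qed.

(** Induction on [j]: the two terms of the difference share their numerators, and their denominators
    differ only in the end factors. By [momS] the difference collapses to the new numerator factor n
    - q - j. *)
Lemma momdiffE (j m : nat) : (j <= m)%N -> (m <= n)%N -> m%:R - 1 < q ->
  momdiff j m =
    \prod_(i < j) ((n%:R - q - i%:R) / (q - m%:R + 1 + i%:R)) * mom m.
Proof.
elim: j m => [|j IH] m jm mn mq; first by rewrite big_ord0 mul1r.
case: m jm mn mq => // m jm mn mq /=.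
have mq' : m%:R < q by move: mq; rewrite -natr1 addrK.
rewrite (IH m) ?(IH m.+1) //; [| lia | lia | lra].
have nm : (n%:R - m%:R : R) != 0 by rewrite subr_eq0 eqr_nat; lia.
have -> : mom m.+1 = (q - m%:R) / (n%:R - m%:R) * mom m.
  by apply: (mulfI nm); rewrite momS //; field.
(* The two denominators are overlapping windows of one arithmetic progression. *)
have shift : \prod_(i < j) (q - m%:R + 1 + i%:R : R) * (q - m%:R)
   = \prod_(i < j.+1) (q - m.+1%:R + 1 + i%:R).
  rewrite big_ord_recl /= addr0 -natr1 opprD addrA subrK mulrC; congr (_ * _).
  by apply: eq_bigr => i _; rewrite /bump /= natrD; ring.
rewrite !prodf_div [\prod_(i < j.+1) (n%:R - _ - _)]big_ord_recr /=.
rewrite -shift.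
have P0 k c : 0 < c -> \prod_(i < k) (c + i%:R : R) != 0.
  by move=> c0; apply/prodf_neq0 => i _; apply/lt0r_neq0; have := ler0n R i; lra.
have := shift; rewrite big_ord_recr /=.
set P := \prod_(i < j) (q - m%:R + 1 + _); set Q := \prod_(i < j) (q - _ + 1 + _).
have P1 : P != 0 by apply: P0; lra.
have Q1 : Q != 0 by apply: P0; rewrite -natr1; lra.
set N := \prod_(i < j) _; set c := (_ + j%:R) => PQ.
have c0 : c != 0 by apply: lt0r_neq0; rewrite /c -natr1; have := ler0n R j; lra.
have qm : q - m%:R != 0 by apply: lt0r_neq0; lra.
have -> : P = Q * c / (q - m%:R) by rewrite -PQ mulfK.
have cE : c = q - m%:R + j%:R by rewrite /c -natr1; ring.
rewrite cE in c0 *; field.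
by rewrite Q1 qm c0 nm.
Qed.

Lemma mom_gt0 m : (m <= n)%N -> m%:R - 1 < q -> 0 < mom m.
Proof.
move=> mn mq; apply: prodr_gt0 => -[i /= im] _.
have im' : (i.+1%:R : R) <= m%:R by rewrite ler_nat.
have mn' : (m%:R : R) <= n%:R by rewrite ler_nat.
by move: im'; rewrite -natr1 => im'; apply: divr_gt0; lra.
Qed.

Lemma momdiff_ge0 (j m : nat) : (j <= m)%N -> (m <= n)%N -> m%:R - 1 < q ->
  j%:R - 1 <= n%:R - q -> 0 <= momdiff j m.
Proof.
move=> jm mn mq jq; rewrite momdiffE //; apply: mulr_ge0; last exact/ltW/mom_gt0.
apply: prodr_ge0 => -[i /= ij] _.
have ij' : (i.+1%:R : R) <= j%:R by rewrite ler_nat.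
by move: ij'; rewrite -natr1 => ij'; have := ler0n R i => ?; apply: divr_ge0; lra.
Qed.

(** On x_I, the sum of x_i over i outside I is |x| - |I|, and |x| acts as q. Indices in [J :\: I]
    leave the union unchanged, those outside [I :|: J] enlarge it by one, and [momS] combines
    both. *)
Lemma mom_setU1 (T : finType) (I J : {set T}) : #|T| = n -> (#|I :|: J| < n)%N ->
  \sum_(i | i \notin I) mom #|(i |: I) :|: J| = (q - #|I|%:R) * mom #|I :|: J|.
Proof.
move=> Tn IJn; rewrite (bigID (fun i => i \in J)) /=.
rewrite (eq_bigr (fun=> mom #|I :|: J|)); last first.
  move=> i /andP[_ iJ]; have -> // : (i |: I) :|: J = I :|: J.
  by apply/setP => y; rewrite !inE; case: eqP => [->|//]; rewrite iJ !orbT.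
rewrite [X in _ + X](eq_bigr (fun=> mom #|I :|: J|.+1)); last first.
  move=> i /andP[iI iJ]; congr mom.
  by rewrite -setUA cardsU1 inE (negPf iI) (negPf iJ).
rewrite !sumr_const.
have -> : #|[pred i | (i \notin I) && (i \in J)]| = #|J :\: I|.
  by apply: eq_card => i; rewrite !inE.
have -> : #|[pred i | (i \notin I) && (i \notin J)]| = #|~: (I :|: J)|.
  by apply: eq_card => i; rewrite !inE negb_or.
have := cardsC (I :|: J); rewrite Tn => C.
have -> : #|~: (I :|: J)| = (n - #|I :|: J|)%N by lia.
have JI : (#|I| + #|J :\: I| = #|I :|: J|)%N.
  by have := cardsU I J; have := cardsD J I; rewrite (setIC J I);
     have := subset_leq_card (subsetIr I J); lia.
rewrite -[X in _ + X]mulr_natl natrB ?(ltnW IJn) // momS //.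
by rewrite -[mom _ *+ #|J :\: I|]mulr_natl -mulrDl -JI natrD; congr (_ * _); ring.
Qed.

(* The solution of the recursion (q - |I|) v(I) = sum_{i notin I} v(i |: I),
   which x_I satisfies modulo |x| - q, with v(I) = [S \subset I] at size
   #|I| + k. *)
Fixpoint top_ext (T : finType) (S : {set T}) (k : nat) (I : {set T}) : R :=
  if k is k'.+1
  then (q - #|I|%:R)^-1 * \sum_(i | i \notin I) top_ext S k' (i |: I)
  else (S \subset I)%:R.

(** Splits the moment matrix into rank-one terms with weights [momdiff]. Both sides obey the same
    recursion in [I] and in [J], so the identity descends from sets of size t to smaller ones. *)
Lemma mom_setU (T : finType) (t k l : nat) (I J : {set T}) : #|T| = n ->
  (2 * t <= n)%N -> (2 * t)%:R - 1 < q ->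
  (#|I| + k = t)%N -> (#|J| + l = t)%N ->
  mom #|I :|: J| = \sum_(S : {set T} | (#|S| <= t)%N)
     momdiff #|S| (2 * t) * (top_ext S k I * top_ext S l J).
Proof.
move=> Tn tn tq; elim: k l I J => [|k IHk] l I J.
  elim: l J => [|l IHl] J /=; rewrite addn0 => It Jt.
    rewrite addn0 in Jt; have IJt := subset_leq_card (subsetIl I J).
    (* At size t the moment depends on the intersection alone, and S lies in it exactly when it lies
       in both sets. *)
    have -> : #|I :|: J| = (2 * t - #|I :&: J|)%N by rewrite cardsU It Jt; lia.
    rewrite -[LHS]/(momdiff 0 _) (momdiff_sum _ (erefl #|I :&: J|)); last first.
      by apply: leq_trans IJt _; rewrite It leq_pmull.
    rewrite [RHS](bigID (fun S : {set _} => S \subset I :&: J)) /=.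
    rewrite [X in _ + X]big1 ?addr0; last first.
      move=> S /andP[_]; rewrite subsetI negb_and.
      by case: (S \subset I); case: (S \subset J) => //=; rewrite ?mul0r ?mulr0.
    apply: eq_big => [S|S].
      case: (boolP (S \subset _)) => [/subset_leq_card SI|]; last by rewrite andbF.
      by rewrite andbT; have := leq_trans SI IJt; rewrite It => ->.
    by rewrite subsetI => /andP[-> ->]; rewrite !mulr1.
  have qJ : q - #|J|%:R != 0.
    apply: lt0r_neq0; rewrite subr_gt0; apply: le_lt_trans tq.
    by rewrite lerBrDr natr1 ler_nat; lia.
  have := mom_setU1 (I := J) (J := I) Tn; rewrite setUC => H.
  apply: (mulfI qJ); rewrite -H; last by have := cardsU I J; lia.
  rewrite mulr_sumr.
  under [RHS]eq_bigr => S _.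
    have -> : (q - #|J|%:R) * (momdiff #|S| (2 * t) *
       ((S \subset I)%:R * ((q - #|J|%:R)^-1 *
          \sum_(i | i \notin J) top_ext S l (i |: J)))) =
      \sum_(i | i \notin J) momdiff #|S| (2 * t) *
        ((S \subset I)%:R * top_ext S l (i |: J)).
      by rewrite -!mulr_sumr; field.
    over.
  rewrite exchange_big /=; apply: eq_bigr => i iJ.
  by rewrite setUC IHl ?addn0 // cardsU1 iJ; lia.
move=> It Jt /=.
have qI : q - #|I|%:R != 0.
  apply: lt0r_neq0; rewrite subr_gt0; apply: le_lt_trans tq.
  by rewrite lerBrDr natr1 ler_nat; lia.
apply: (mulfI qI); rewrite -(mom_setU1 Tn); last by have := cardsU I J; lia.
rewrite mulr_sumr.
under [RHS]eq_bigr => S _.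
  have -> : (q - #|I|%:R) * (momdiff #|S| (2 * t) *
     ((q - #|I|%:R)^-1 * (\sum_(i | i \notin I) top_ext S k (i |: I)) *
        top_ext S l J)) =
    \sum_(i | i \notin I) momdiff #|S| (2 * t) *
      (top_ext S k (i |: I) * top_ext S l J).
    by rewrite -mulr_sumr -mulr_suml; field.
  over.
rewrite exchange_big /=; apply: eq_bigr => i iI.
by rewrite (IHk l) //; rewrite cardsU1 iI; lia.
Qed.

End Moments.

(** * Degrees in sums of squares *)

Section SumsOfSquares.
Variables (R : realDomainType) (n : nat).
Implicit Types (p f : {mpoly R[n]}).

(** Nonnegative leading coefficients cannot cancel: the larger leading monomial survives, and at
    equal ones the coefficients add up. *)
Lemma mleadc_ge0D p f : 0 <= mleadc p -> 0 <= mleadc f ->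
  0 <= mleadc (p + f) /\ (msize p <= msize (p + f))%N.
Proof.
have [->|p0] := eqVneq p 0; first by rewrite add0r msize0.
have [->|f0] := eqVneq f 0; first by rewrite addr0.
move=> pge fge.
have pgt : 0 < mleadc p by rewrite lt_def mleadc_eq0 p0.
have fgt : 0 < mleadc f by rewrite lt_def mleadc_eq0 f0.
suff [cgt le] : 0 < mleadc (p + f) /\ (mlead p <= mlead (p + f))%O.
  split; first exact: ltW.
  have pf0 : p + f != 0 by rewrite -mleadc_eq0 gt_eqF.
  by rewrite -!mlead_deg // ltnS lemc_mdeg.
have [lt|lt|eq] := ltgtP (mlead p) (mlead f).
- by rewrite mleadDr // mcoeffD mcoeff_gt_mlead // add0r ltW.
- by rewrite mleadDl // mcoeffD (mcoeff_gt_mlead lt) addr0.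
have cgt : 0 < (p + f)@_(mlead p) by rewrite mcoeffD {2}eq addr_gt0.
have -> : mlead (p + f) = mlead p; last by split.
apply: le_anti; apply/andP; split.
  by apply: le_trans (mleadD_le _ _) _; rewrite -eq joinxx.
by rewrite msupp_le_mlead // mcoeff_msupp gt_eqF.
Qed.

Lemma mleadc_sqr_ge0 p : 0 <= mleadc (p ^+ 2).
Proof.
have [->|p0] := eqVneq p 0; first by rewrite expr0n mcoeff0.
by rewrite mleadX // mleadcX sqr_ge0.
Qed.

(** Leading coefficients of squares are squares. This passes the degree bound on a sum of squares to
    each term. *)
Lemma msize_sum_sqr (s : seq {mpoly R[n]}) f : f \in s ->
  (msize (f ^+ 2) <= msize (\sum_(g <- s) g ^+ 2))%N.
Proof.
have sum_ge0 (u : seq {mpoly R[n]}) : 0 <= mleadc (\sum_(g <- u) g ^+ 2).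
  elim: u => [|g u IH]; first by rewrite big_nil mcoeff0.
  by rewrite big_cons; case: (mleadc_ge0D (mleadc_sqr_ge0 g) IH).
elim: s => //= g s IH; rewrite inE big_cons => /orP[/eqP ->|fs].
  by case: (mleadc_ge0D (mleadc_sqr_ge0 g) (sum_ge0 s)).
apply: leq_trans (IH fs) _; rewrite addrC.
by case: (mleadc_ge0D (sum_ge0 s) (mleadc_sqr_ge0 g)).
Qed.

Lemma msize_sqr p k : (msize (p ^+ 2) <= (2 * k).+1)%N -> (msize p <= k.+1)%N.
Proof.
have [->|p0] := eqVneq p 0; first by rewrite msize0.
by rewrite expr2 msizeM //; move: (msize p) => m; lia.
Qed.

End SumsOfSquares.

(** * The pseudo-expectation as a signed measure on the cube *)

Section CubeMoments.
Variables (R : realType) (n : nat) (q : R).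

Definition cube_point (A : {set 'I_n}) : {ffun 'I_n -> bool} :=
  [ffun i => i \in A].

Definition mnm_supp (m : 'X_{1..n}) : {set 'I_n} := [set i | m i != 0%N].

Lemma weight_cube_point (A : {set 'I_n}) : weight (cube_point A) = #|A|.
Proof.
rewrite /weight -sum1_card [RHS]big_mkcond; apply: eq_bigr => i _.
by rewrite ffunE; case: (i \in A).
Qed.

Lemma card_mnm_supp (m : 'X_{1..n}) : (#|mnm_supp m| <= mdeg m)%N.
Proof.
rewrite mdegE -sum1_card [X in (X <= _)%N]big_mkcond; apply: leq_sum => i _.
by rewrite inE; case: (m i).
Qed.

(** On the cube x_i^e = x_i for e > 0, so only the support of a monomial matters. *)
Lemma eval_cube_point (p : {mpoly R[n]}) (A : {set 'I_n}) :
  eval_cube p (cube_point A) =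
    \sum_(m <- msupp p) p@_m * (mnm_supp m \subset A)%:R.
Proof.
rewrite /eval_cube mevalE; apply: eq_bigr => m _; congr (_ * _).
case: (boolP (_ \subset A)) => [/subsetP mA | /subsetPn[i]].
  rewrite big1 // => i _; rewrite ffunE.
  case: (boolP (i \in A)) => [_|iA]; first by rewrite expr1n.
  have : i \notin mnm_supp m by apply: contra iA => /mA.
  by rewrite inE negbK => /eqP ->.
rewrite inE => mi iA; rewrite (bigD1 i) //= ffunE (negPf iA) expr0n.
by rewrite (negPf mi) mul0r.
Qed.

Variable mu : {set 'I_n} -> R.
Hypothesis mu_mom : forall I : {set 'I_n},
  \sum_(A : {set 'I_n} | I \subset A) mu A = mom n q #|I|.

Lemma mu_subset (I : {set 'I_n}) :
  \sum_A mu A * (I \subset A)%:R = mom n q #|I|.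
Proof.
rewrite -mu_mom [RHS]big_mkcond; apply: eq_bigr => A _.
by case: (I \subset A); rewrite ?mulr1 ?mulr0.
Qed.

(** Linearity reduces this to monomials; degree below n keeps their supports in the range of
    [mom_setU1]. *)
Lemma mu_knapsack (p : {mpoly R[n]}) : (msize p <= n)%N ->
  \sum_A mu A * (eval_cube p (cube_point A) * (#|A|%:R - q)) = 0.
Proof.
move=> pn.
under eq_bigr do rewrite eval_cube_point mulr_suml mulr_sumr.
rewrite exchange_big big_seq big1 //= => m mp.
have mn : (#|mnm_supp m| < n)%N.
  by apply: leq_ltn_trans (card_mnm_supp m) (leq_trans _ pn); apply: msize_mdeg_lt.
set I := mnm_supp m in mn *.
transitivity (p@_m * (\sum_A mu A * (#|A|%:R * (I \subset A)%:R)
                      - q * \sum_A mu A * (I \subset A)%:R)).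
  by rewrite mulr_sumr -sumrB mulr_sumr; apply: eq_bigr => A _; ring.
rewrite mu_subset.
have -> : \sum_A mu A * (#|A|%:R * (I \subset A)%:R) =
    \sum_(i : 'I_n) mom n q #|i |: I|.
  under [RHS]eq_bigr do rewrite -mu_subset.
  rewrite exchange_big; apply: eq_bigr => A _ /=.
  rewrite -mulr_sumr; congr (_ * _); rewrite -sum1_card natr_sum mulr_suml.
  rewrite big_mkcond; apply: eq_bigr => i _.
  by rewrite subUset sub1set; case: (i \in A); rewrite ?mul1r.
rewrite (bigID (fun i => i \in I)) /=.
rewrite (eq_bigr (fun=> mom n q #|I|)); last first.
  by move=> i iI; rewrite (setUidPr _) // sub1set.
rewrite sumr_const.
have := mom_setU1 q (I := I) (J := set0) (card_ord n).
rewrite setU0 => /(_ mn) H.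
rewrite (eq_bigr (fun i => mom n q #|(i |: I) :|: set0|)); last first.
  by move=> i _; rewrite setU0.
by rewrite H -[mom _ _ _ *+ _]mulr_natl; ring.
Qed.

(** The left side is the moment matrix evaluated at the coefficients of [p]; [mom_setU] turns it
    into squares weighted by [momdiff]. *)
Lemma mu_sqr_ge0 (t : nat) (p : {mpoly R[n]}) :
  (2 * t <= n)%N -> (2 * t)%:R - 1 < q -> t%:R - 1 <= n%:R - q ->
  (msize p <= t.+1)%N ->
  0 <= \sum_A mu A * eval_cube (p ^+ 2) (cube_point A).
Proof.
move=> tn tq tq' pt.
have supp_t m : m \in msupp p -> (#|mnm_supp m| + (t - #|mnm_supp m|) = t)%N.
  move=> mp; rewrite subnKC //; apply: leq_trans (card_mnm_supp m) _.
  by rewrite -ltnS (leq_trans (msize_mdeg_lt mp)).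
pose v (S I : {set 'I_n}) := top_ext q S (t - #|I|) I.
suff -> : \sum_A mu A * eval_cube (p ^+ 2) (cube_point A) =
    \sum_(S : {set 'I_n} | (#|S| <= t)%N) momdiff n q #|S| (2 * t) *
       (\sum_(m <- msupp p) p@_m * v S (mnm_supp m)) ^+ 2.
  apply: sumr_ge0 => S St; rewrite mulr_ge0 ?sqr_ge0 // momdiff_ge0 //; first lia.
  by apply: le_trans tq'; rewrite lerD2r ler_nat.
transitivity (\sum_(m <- msupp p) \sum_(m' <- msupp p) p@_m * p@_m' *
    mom n q #|mnm_supp m :|: mnm_supp m'|).
  under eq_bigr => A _.
    rewrite /eval_cube rmorphXn /= -/(eval_cube p _) eval_cube_point expr2.
    rewrite mulr_suml mulr_sumr.
    under eq_bigr do rewrite mulr_sumr mulr_sumr.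
    over.
  rewrite exchange_big; apply: eq_bigr => m _ /=.
  rewrite exchange_big; apply: eq_bigr => m' _ /=.
  rewrite -mu_subset mulr_sumr; apply: eq_bigr => A _.
  by rewrite subUset; case: (mnm_supp m \subset A);
     case: (mnm_supp m' \subset A); rewrite /=; ring.
under [RHS]eq_bigr => S _.
  rewrite expr2 mulr_suml mulr_sumr.
  under eq_bigr do rewrite mulr_sumr mulr_sumr.
  over.
rewrite [RHS]exchange_big big_seq [RHS]big_seq; apply: eq_bigr => m mp /=.
rewrite [RHS]exchange_big big_seq [RHS]big_seq; apply: eq_bigr => m' mp' /=.
rewrite (mom_setU (card_ord n) tn tq (supp_t _ mp) (supp_t _ mp')) mulr_sumr.
by apply: eq_bigr => S _; rewrite /v; ring.
Qed.

End CubeMoments.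

(** * Excluding certificates, and the rank bound *)

Lemma MK_not_certifiable (R : realType) (n d : nat) (q : R) :
  (2 * d.+1 <= n)%N -> (2 * d.+1)%:R - 1 < q -> d%:R <= n%:R - q ->
  q < (Num.ceil q)%:~R -> ~ MK_certifiable n q d.
Proof.
move=> dn dq dq' qc [s0 [s1 [[s s0E] _ ds0 ds1 cert]]].
have [mu mu_mom] := moment_measure (fun I : {set 'I_n} => mom n q #|I|).
have s0_ge0 : 0 <= \sum_A mu A * eval_cube s0 (cube_point A).
  have s0A A : mu A * eval_cube s0 (cube_point A) =
      \sum_(g <- s) mu A * eval_cube (g ^+ 2) (cube_point A).
    by rewrite /eval_cube s0E rmorph_sum mulr_sumr.
  rewrite (eq_bigr _ (fun A _ => s0A A)) exchange_big big_seq; apply: sumr_ge0 => g gs /=.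
  apply: (mu_sqr_ge0 (t := d.+1) mu_mom) => //.
    by rewrite -natr1 addrK.
  apply: msize_sqr; apply: leq_trans (msize_sum_sqr gs) _.
  by rewrite -s0E; apply: leq_trans ds0 _; lia.
have s1_eq0 := mu_knapsack mu_mom (leq_trans ds1 _).
have one_eq0 := mu_knapsack mu_mom (p := 1).
have one (A : {set 'I_n}) : eval_cube (1 : {mpoly R[n]}) (cube_point A) = 1.
  by rewrite /eval_cube rmorph1.
have tot := mu_subset mu_mom set0; rewrite cards0 mom0 in tot.
have E : \sum_A mu A * eval_cube s0 (cube_point A) = q - (Num.ceil q)%:~R.
  (* Splits |x| - ceil q as (|x| - q) + (q - ceil q): the first two sums vanish and the total mass
     is 1. *)
  transitivity (\sum_A mu A * (eval_cube 1 (cube_point A) * (#|A|%:R - q))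
      - \sum_A mu A * (eval_cube s1 (cube_point A) * (#|A|%:R - q))
      + (q - (Num.ceil q)%:~R) * \sum_A mu A * (set0 \subset A)%:R).
    rewrite mulr_sumr -sumrB -big_split /=; apply: eq_bigr => A _.
    have := cert (cube_point A); rewrite weight_cube_point sub0set one => H.
    have -> : eval_cube s0 (cube_point A) = #|A|%:R - (Num.ceil q)%:~R
       - eval_cube s1 (cube_point A) * (#|A|%:R - q) by rewrite H; ring.
    by rewrite mulr1; move: (_%:~R) => c; ring.
  by rewrite tot s1_eq0 ?one_eq0 ?msize1; [ring | lia | lia].
by move: s0_ge0; rewrite E subr_ge0 leNgt qc.
Qed.

Lemma eval_cube_sos_ge0 (R : realType) (n : nat) (p : {mpoly R[n]}) x :
  is_sos p -> 0 <= eval_cube p x.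
Proof.
move=> [s ->]; rewrite /eval_cube rmorph_sum; apply: sumr_ge0 => g _ /=.
by rewrite rmorphXn sqr_ge0.
Qed.

Lemma ceil_eq_natS (R : archiRealFieldType) (q : R) (k : nat) :
  k%:R < q -> q <= k.+1%:R -> Num.ceil q = Posz k.+1.
Proof.
by move=> kq qk; apply: ceil_def; rewrite (_ : Posz k.+1 - 1 = k) ?kq //; lia.
Qed.

(* The certificate at |x| = k forces the constant s1 to be positive, and at
   |x| = k + 1 to be nonpositive. *)
Lemma MK_not_certifiable0 (R : realType) (n k : nat) (q : R) :
  (k < n)%N -> k%:R < q -> q < k.+1%:R -> ~ MK_certifiable n q 0.
Proof.
move=> kn kq qk [s0 [s1 [sos0 sos1 _ ds1 cert]]].
have [c s1E] : exists c, s1 = c%:MP by exists s1@_0; apply: msize1_polyC.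
have qE : Num.ceil q = Posz k.+1.
  exact: ceil_eq_natS kq (ltW qk).
have pt j : (j <= n)%N -> exists A : {set 'I_n}, #|A| = j.
  move=> jn; exists [set widen_ord jn i | i : 'I_j].
  rewrite card_imset ?card_ord // => i i' /(congr1 val) ii'.
  exact: val_inj.
have s1c x : eval_cube s1 x = c by rewrite /eval_cube s1E mevalC.
have [A Ak] := pt _ (ltnW kn); have [B Bk] := pt _ kn.
have := cert (cube_point A); have := cert (cube_point B).
rewrite !weight_cube_point Ak Bk qE !s1c -natr1.
have := eval_cube_sos_ge0 (cube_point A) sos0.
have := eval_cube_sos_ge0 (cube_point B) sos0.
have := eval_cube_sos_ge0 (cube_point A) sos1; rewrite s1c.
have : (Posz k.+1)%:~R = k%:R + 1 :> R by rewrite natr1.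
move: qk; rewrite -natr1 => qk -> c0 B0 A0 HB HA.
by have := mulr_ge0 c0 (_ : 0 <= k%:R + 1 - q); nra.
Qed.

Theorem theorem3p1 (R : realType) :
  exists c : R, 0 < c /\
    forall (n : nat) (q : R),
      (1 <= n)%N -> 0 < q -> q < n%:R -> q - (Num.floor q)%:~R != 0 ->
      c * Num.min (Num.ceil q)%:~R (n%:R - (Num.floor q)%:~R)
        <= (MK_sos_rank n q)%:R.
Proof.
(* If 3d < min(k + 1, n - k) with k the floor of q and d >= 1, then 2d + 1 <= 3d <= k < q and d <=
   3d <= n - k - 1 < n - q, as [MK_not_certifiable] requires. *)
exists 3^-1; split; first by rewrite invr_gt0.
move=> n q _ q0 qn; have [cert _] := MK_sos_rankP n q.
set d := MK_sos_rank n q in cert *.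
have := floor_itv q; have : 0 <= Num.floor q by rewrite floor_ge0 ltW.
case: (Num.floor q) => // k _.
have -> : (Posz k + 1)%:~R = k%:R + 1 :> R by rewrite intrD.
have -> : (Posz k)%:~R = k%:R :> R by [].
move=> /andP[kq qk]; rewrite subr_eq0 => qk'.
have {qk'} kq : k%:R < q by rewrite lt_def qk'.
have cE : (Num.ceil q)%:~R = k.+1%:R :> R.
  by rewrite (ceil_eq_natS kq) // -natr1 ltW.
rewrite cE leNgt mulrC ltr_pdivlMr // lt_min; apply/negP => /andP[d1 d2].
have kn : (k < n)%N by rewrite -(ltr_nat R); exact: lt_trans qn.
have {}d1 : (d * 3 < k.+1)%N by rewrite -(ltr_nat R) natrM.
have {}d2 : (d * 3 < n - k)%N by rewrite -(ltr_nat R) natrM natrB // ltnW.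
case: d => [|d] in cert d1 d2 *.
  by apply: (MK_not_certifiable0 kn kq _ cert); rewrite -natr1.
have dk : (3 * d.+1)%:R <= k%:R :> R by rewrite ler_nat; lia.
have dn : (3 * d.+1)%:R + k%:R + 1 <= n%:R :> R by rewrite -natrD natr1 ler_nat; lia.
have d0 := ler0n R d; move: dk dn; rewrite !natrM -!natr1 => dk dn.
apply: MK_not_certifiable cert; first by lia.
- by rewrite natrM -!natr1; lra.
- by rewrite -natr1; lra.
by rewrite cE -natr1.
Qed.
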